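(* Suppose that the value group $\Gamma$ of $\nu$ is a non-discrete subgroup of $\mathbb{Q}$. Let $\{H_l\}_{l\ge0}$ be the sequence of all independent jumping polynomials in $R$ and let $\bar p_1$ be the associated integer (both as defined in the context, for a regular system of parameters $(u,v)$ of $R$ and a sequence of units $\{\delta_i\}_{i>0}\subset R$ with residue $1$). Then $\{H_l\}_{l\ge0}$ forms a generating sequence of $\nu$ in $R$. Moreover, if $\bar p_1\ne1$ then $\{H_l\}_{l\ge0}$ is a minimal generating sequence in $R$, and if $\bar p_1=1$ then $\{H_l\}_{l>0}$ forms a minimal generating sequence in $R$.
   Context: Setting: $\mathbf{k}$ is an algebraically closed field of characteristic $\mathbf{p}>0$, $K$ is an algebraic function field of transcendence degree $2$ over $\mathbf{k}$, and $\nu$ is a $\mathbf{k}$-valuation of $K$ with valuation ring $V$ and value group $\Gamma$, where $\Gamma\subset\mathbb{Q}$ and $V/m_V$ has transcendence degree $0$ over $\mathbf{k}$ (so $V/m_V=\mathbf{k}$). $R$ is a two-dimensional regular local ring, essentially of finite type over $\mathbf{k}$, with quotient field $K$, dominated by $V$. Generating sequences: let $\Phi=\nu(R\setminus\{0\})$ and $I_\gamma=\{f\in R\mid\nu(f)\ge\gamma\}$ for $\gamma\in\Phi$. A possibly infinite sequence $\{Q_i\}\subset R$ is a generating sequence of $\nu$ in $R$ if for every $\gamma\in\Phi$ the ideal $I_\gamma$ is generated by $\{\prod_iQ_i^{a_i}\mid a_i\in\mathbb{N}_0,\ \sum_ia_i\nu(Q_i)\ge\gamma\}$ (finite products). It is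 minimal if none of its proper subsequences is a generating sequence of $\nu$. Jumping polynomials: let $(u,v)$ be a regular system of parameters of $R$ and let $\{\delta_i\}_{i>0}\subset R$ be units with $\delta_i-1\in m_R$. Normalize $\Gamma$ so that $\nu(u)=1$. Set $T_0=u$, $T_1=v$, $q_0=\infty$, and let $(p_1,q_1)$ be the coprime positive integers with $\nu(v)=p_1/q_1$. For $i\ge1$, let $$T_{i+1}=T_i^{q_i}-\lambda_i\delta_i\prod_{j=0}^{i-1}T_j^{n_{i,j}},$$ where $n_{i,j}<q_j$ are the (uniquely determined) nonnegative integers with $q_i\nu(T_i)=\nu(\prod_{j=0}^{i-1}T_j^{n_{i,j}})$, and $\lambda_i\in\mathbf{k}\setminus\{0\}$ is the residue of $T_i^{q_i}(\prod_{j=0}^{i-1}T_j^{n_{i,j}})^{-1}$; $p_{i+1},q_{i+1}$ are the coprime positive integers with $\nu(T_{i+1})=q_i\nu(T_i)+\frac{1}{q_1\cdots q_i}\cdot\frac{p_{i+1}}{q_{i+1}}$. Independent jumping polynomials: $T_i$ is independent if $q_i\ne1$ (so $T_0$ is independent). Let $0=i_0<i_1<i_2<\dots$ be the indices of all independent jumping polynomials (infinitely many when $\Gamma$ is non-discrete), and put $H_l=T_{i_l}$, and for $l>0$, $\bar q_l=q_{i_l}$ and $\bar p_l=(p_{i_{l-1}+1}+\dots+p_{i_l-1})\bar q_l+p_{i_l}$. In particular $\bar p_1=(p_1+\dots+p_{i_1-1})q_{i_1}+p_{i_1}$. *)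

(* Defs.v *)
From HB Require Import structures.
From mathcomp Require Import all_boot all_order all_algebra.
From mathcomp.multinomials Require Import mpoly.

Set Implicit Arguments.
Unset Strict Implicit.
Unset Printing Implicit Defensive.

Import Order.TTheory GRing.Theory Num.Theory.
Local Open Scope ring_scope.

(* A k-algebra structure on a commutative ring A is a morphism
   kA : {rmorphism k -> A}; [mmap kA a P] is then the value P(a) in A of the
   polynomial P at the family a. *)

(** Commutative algebra *)

Definition ideal_span (R : comNzRingType) (S : R -> Prop) (f : R) : Prop :=
  exists (m : nat) (c g : 'I_m -> R),
    (forall i, S (g i)) /\ f = \sum_(i < m) c i * g i.

(* [idealr_closed] only describes proper ideals; the unit ideal is
   generated by 1 in any case. *)
Definition noetherian (R : comNzRingType) : Prop :=
  forall I : {pred R}, idealr_closed I ->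
    exists s : seq R, forall f, f \in I <-> ideal_span (fun g => g \in s) f.

Definition prime_chain (R : comNzRingType) (d : nat)
    (P : 'I_d.+1 -> {pred R}) : Prop :=
  (forall i, idealr_closed (P i) /\ prime_idealr_closed (P i)) /\
  (forall i j : 'I_d.+1, (i < j)%N ->
     {subset P i <= P j} /\ exists2 f, f \in P j & f \notin P i).

Definition krull_dim (R : comNzRingType) (d : nat) : Prop :=
  (exists P : 'I_d.+1 -> {pred R}, prime_chain P) /\
  (forall P : 'I_d.+2 -> {pred R}, ~ prime_chain P).

Definition max_ideal (R : comUnitRingType) : {pred R} :=
  [pred f | f \isn't a GRing.unit].

Arguments max_ideal R : clear implicits.

Definition is_local (R : comUnitRingType) : Prop :=
  {in max_ideal R &, forall f g, f + g \in max_ideal R}.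

(* A regular system of parameters when R is regular local of dimension d. *)
Definition regular_parameters (R : comUnitRingType) (d : nat)
    (x : 'I_d -> R) : Prop :=
  forall f, f \in max_ideal R <-> ideal_span (fun g => exists i, g = x i) f.

Definition regular_local_ring (R : comUnitRingType) (d : nat) : Prop :=
  [/\ is_local R, noetherian R, krull_dim R d
    & exists x : 'I_d -> R, regular_parameters x].

(* R is the localization of its finitely generated subalgebra k[a] at the
   multiplicative set of all values Q(a) that are units of R. *)
Definition essentially_finite_type (k : fieldType) (R : comUnitRingType)
    (kR : {rmorphism k -> R}) : Prop :=
  exists (m : nat) (a : 'I_m -> R), forall f : R,
    exists P Q : {mpoly k[m]},
      mmap kR a Q \is a GRing.unit /\ f = mmap kR a P / mmap kR a Q.

Definition is_fraction_field (R : idomainType) (K : fieldType)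
    (RK : {rmorphism R -> K}) : Prop :=
  injective RK /\
  forall x : K, exists a b : R, b != 0 /\ x = RK a / RK b.

(** Function fields *)

Definition alg_independent (k K : fieldType) (kK : {rmorphism k -> K})
    (d : nat) (t : 'I_d -> K) : Prop :=
  forall P : {mpoly k[d]}, mmap kK t P = 0 -> P = 0.

Definition trdeg (k K : fieldType) (kK : {rmorphism k -> K}) (d : nat) : Prop :=
  (exists t : 'I_d -> K, alg_independent kK t) /\
  (forall t : 'I_d.+1 -> K, ~ alg_independent kK t).

Definition fin_gen_field (k K : fieldType) (kK : {rmorphism k -> K}) : Prop :=
  exists (m : nat) (a : 'I_m -> K), forall x : K,
    exists P Q : {mpoly k[m]},
      mmap kK a Q != 0 /\ x = mmap kK a P / mmap kK a Q.

Definition function_field (k K : fieldType) (kK : {rmorphism k -> K})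
    (d : nat) : Prop :=
  fin_gen_field kK /\ trdeg kK d.

(** Valuations with values in the rationals *)

(* The value of nu at 0, which stands for infinity, is left unspecified:
   everything below treats 0 separately. *)
Record k_valuation (k K : fieldType) (kK : {rmorphism k -> K})
    (nu : K -> rat) : Prop := KValuation {
  valM : forall x y, x != 0 -> y != 0 -> nu (x * y) = nu x + nu y;
  valD : forall x y, x != 0 -> y != 0 -> x + y != 0 ->
           Num.min (nu x) (nu y) <= nu (x + y);
  valC : forall c, c != 0 -> nu (kK c) = 0
}.

Definition val_ring (K : fieldType) (nu : K -> rat) : {pred K} :=
  [pred x | (x == 0) || (0 <= nu x)].

Definition val_ideal (K : fieldType) (nu : K -> rat) : {pred K} :=
  [pred x | (x == 0) || (0 < nu x)].

Definition value_group (K : fieldType) (nu : K -> rat) (g : rat) : Prop :=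
  exists2 x, x != 0 & nu x = g.

Definition discrete_subset (G : rat -> Prop) : Prop :=
  forall g, G g -> exists2 e : rat, 0 < e &
    forall g', G g' -> `|g' - g| < e -> g' = g.

(* V / m_V is algebraic over k. *)
Definition residue_trdeg0 (k K : fieldType) (kK : {rmorphism k -> K})
    (nu : K -> rat) : Prop :=
  forall x, x \in val_ring nu ->
    exists2 P : {poly k}, P != 0 & (map_poly kK P).[x] \in val_ideal nu.

Definition is_residue (k K : fieldType) (kK : {rmorphism k -> K})
    (nu : K -> rat) (x : K) (c : k) : Prop :=
  x \in val_ring nu /\ x - kK c \in val_ideal nu.

Definition dominated (R : idomainType) (K : fieldType)
    (RK : {rmorphism R -> K}) (nu : K -> rat) : Prop :=
  (forall f, RK f \in val_ring nu) /\
  (forall f, f \in max_ideal R <-> RK f \in val_ideal nu).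

(** Generating sequences; [w] is the restriction of the valuation to R *)

Definition value_semigroup (R : idomainType) (w : R -> rat) (g : rat) : Prop :=
  exists2 f, f != 0 & w f = g.

Definition val_filtration (R : idomainType) (w : R -> rat) (g : rat) (f : R) :
    Prop :=
  f = 0 \/ g <= w f.

(* A possibly infinite sequence is a family (Q_i) with i ranging over a subset
   D of nat; subsequences correspond to subsets of D. *)
Definition monomial_ge (R : idomainType) (w : R -> rat) (D : pred nat)
    (Q : nat -> R) (g : rat) (f : R) : Prop :=
  exists (N : nat) (a : nat -> nat),
    g <= \sum_(i < N | D i) w (Q i) *+ a i /\ f = \prod_(i < N | D i) Q i ^+ a i.

Definition generating_sequence (R : idomainType) (w : R -> rat) (D : pred nat)
    (Q : nat -> R) : Prop :=
  forall g, value_semigroup w g ->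
    forall f, val_filtration w g f <-> ideal_span (monomial_ge w D Q g) f.

Definition minimal_generating_sequence (R : idomainType) (w : R -> rat)
    (D : pred nat) (Q : nat -> R) : Prop :=
  generating_sequence w D Q /\
  forall D' : pred nat, {subset D' <= D} -> (exists2 i, i \in D & i \notin D') ->
    ~ generating_sequence w D' Q.

(** Jumping polynomials *)

Definition jp_monomial (R : idomainType) (T : nat -> R) (n : nat -> nat -> nat)
    (i : nat) : R :=
  \prod_(j < i) T j ^+ n i j.

(* Since q_0 is infinite, it does not bound n_{i,0}; the value q 0 is unused.
   [jp_neq0] is the part of [jp_valS] saying that the value is finite. *)
Record jumping_polynomials (k K : fieldType) (R : idomainType)
    (kR : {rmorphism k -> R}) (RK : {rmorphism R -> K}) (nu : K -> rat)
    (u v : R) (delta : nat -> R) (T : nat -> R) (p q : nat -> nat)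
    (n : nat -> nat -> nat) (lam : nat -> k) : Prop := JumpingPolynomials {
  jp_T0 : T 0 = u;
  jp_T1 : T 1 = v;
  jp_coprime : forall i, (0 < i)%N ->
    [/\ (0 < p i)%N, (0 < q i)%N & coprime (p i) (q i)];
  jp_val1 : nu (RK v) = (p 1)%:R / (q 1)%:R;
  jp_exp : forall i j, (0 < j < i)%N -> (n i j < q j)%N;
  jp_val : forall i, (0 < i)%N ->
    nu (RK (T i)) *+ q i = nu (RK (jp_monomial T n i));
  jp_lam : forall i, (0 < i)%N ->
    lam i != 0 /\
    is_residue (RK \o kR) nu (RK (T i ^+ q i) / RK (jp_monomial T n i)) (lam i);
  jp_TS : forall i, (0 < i)%N ->
    T i.+1 = T i ^+ q i - kR (lam i) * delta i * jp_monomial T n i;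
  jp_neq0 : forall i, T i != 0;
  jp_valS : forall i, (0 < i)%N ->
    nu (RK (T i.+1)) =
      nu (RK (T i)) *+ q i +
      (\prod_(1 <= j < i.+1) (q j)%:R)^-1 * ((p i.+1)%:R / (q i.+1)%:R)
}.

Definition independent_jp (q : nat -> nat) (i : nat) : bool :=
  (i == 0)%N || (q i != 1)%N.

Definition independent_indices (q idx : nat -> nat) : Prop :=
  {homo idx : l m / (l < m)%N} /\
  forall i, independent_jp q i <-> exists l, idx l = i.

(* For l > 0. *)
Definition pbar (p q idx : nat -> nat) (l : nat) : nat :=
  ((\sum_((idx l.-1).+1 <= j < idx l) p j) * q (idx l) + p (idx l))%N.

(* Main.v *)
Require Import Defs.
From HB Require Import structures.
From mathcomp Require Import all_boot all_order all_algebra.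
From mathcomp.multinomials Require Import mpoly.
From mathcomp Require Import ring lra.

(* Two monomials in the T_i of the same value g agree up to a unit modulo the
   ideal spanned by the monomials of value > g: the value of T_i has order
   exactly q_i modulo the group generated by the previous values, so the
   exponents of the top T_i differ by a multiple of q_i, and T_i^q_i is a unit
   times a monomial in the previous T_j modulo T_{i+1}.  Hence if f lies in the
   ideal spanned by the monomials of value >= g and nu f > g, then f = e M
   modulo higher values with nu M = g and e a nonunit; as m_R = (T_0, T_1), f
   lies in the ideal of value > g.  Since nu T_i is unbounded, only finitely many
   T_i are involved below nu f, so monomial values there have bounded denominators
   and the process reaches nu f.  A dependent T_i is T_{i+1} plus a unit times a
   monomial in independent T_j, so the H_l suffice.  For minimality, the value of
   a redundant H_i would be a sum of values of other H_l, against the order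
   statement (i > 0) or the coprimality of p-bar_1 and q-bar_1 (i = 0). *)

Set Implicit Arguments.
Unset Strict Implicit.
Unset Printing Implicit Defensive.

Import Order.TTheory GRing.Theory Num.Theory.
Local Open Scope ring_scope.

(** * Ideals spanned by monomials of bounded value *)

Section IdealSpan.

Variables (R : comNzRingType) (S : R -> Prop).

Lemma ideal_span_ind (P : R -> Prop) :
    P 0 -> (forall c g x, S g -> P x -> P (c * g + x)) ->
  forall f, ideal_span S f -> P f.
Proof.
move=> P0 Pcons f [m [c [g [Sg ->]]]] {f}.
elim: m c g Sg => [|m IHm] c g Sg; first by rewrite big_ord0.
by rewrite big_ord_recl; apply: Pcons => //; apply: IHm => i; apply: Sg.
Qed.

Lemma ideal_span0 : ideal_span S 0.
Proof.
by exists 0, (fun=> 0), (fun=> 0); rewrite big_ord0; split=> // -[].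
Qed.

Lemma ideal_span_cons c g x :
  S g -> ideal_span S x -> ideal_span S (c * g + x).
Proof.
move=> Sg [m [c' [g' [Sg' ->]]]].
exists m.+1, (fun i : 'I_m.+1 => oapp c' c (unlift ord0 i)),
  (fun i : 'I_m.+1 => oapp g' g (unlift ord0 i)); split.
  by move=> i; case: unliftP => [j|] _ /=.
rewrite big_ord_recl unlift_none; congr (_ + _).
by apply: eq_bigr => i _; rewrite liftK.
Qed.

Lemma ideal_span_gen g : S g -> ideal_span S g.
Proof.
by move=> Sg; rewrite -[g]addr0 -[g]mul1r; apply/ideal_span_cons/ideal_span0.
Qed.

Lemma ideal_spanD f g :
  ideal_span S f -> ideal_span S g -> ideal_span S (f + g).
Proof.
move=> Sf Sg; elim/ideal_span_ind: f / Sf => [|c h x Sh IH];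
  first by rewrite add0r.
by rewrite -addrA; apply: ideal_span_cons.
Qed.

Lemma ideal_spanZ c f : ideal_span S f -> ideal_span S (c * f).
Proof.
elim/ideal_span_ind => [|d h x Sh IH]; first by rewrite mulr0;
  apply: ideal_span0.
by rewrite mulrDr mulrA; apply: ideal_span_cons.
Qed.

End IdealSpan.

Lemma ideal_span_sub (R : comNzRingType) (S S' : R -> Prop) :
    (forall g, S g -> ideal_span S' g) ->
  forall f, ideal_span S f -> ideal_span S' f.
Proof.
move=> sub f; elim/ideal_span_ind => [|c g x Sg IH]; first exact: ideal_span0.
by apply: ideal_spanD => //; apply/ideal_spanZ/sub.
Qed.

Section MonomialIdeal.

Variables (R : idomainType) (w : R -> rat).
Implicit Types (D : pred nat) (Q : nat -> R) (g : rat) (f : R) (a : nat -> nat).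

Definition mono_ideal D Q g f : Prop := ideal_span (monomial_ge w D Q g) f.

(** A combination has finitely many terms, so a single bound g' > g serves for all of them; keeping
    g' explicit records a definite gain in value. *)
Definition mono_ideal_gt D Q g f : Prop :=
  exists2 g', g < g' & mono_ideal D Q g' f.

(** Padding with zero exponents brings two monomials to a common length. *)
Lemma widen_exponent D Q N N' a (a' := fun i => if (i < N)%N then a i else 0) :
    (N <= N')%N ->
  \sum_(i < N | D i) w (Q i) *+ a i = \sum_(i < N' | D i) w (Q i) *+ a' i
  /\ \prod_(i < N | D i) Q i ^+ a i = \prod_(i < N' | D i) Q i ^+ a' i.
Proof.
move=> leNN'; split.
  rewrite (big_ord_widen_cond N' D (fun i => w (Q i) *+ a i)) // big_mkcondr.
  by apply: eq_bigr => i _; rewrite /a'; case: ifP.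
rewrite (big_ord_widen_cond N' D (fun i => Q i ^+ a i)) // big_mkcondr.
by apply: eq_bigr => i _; rewrite /a'; case: ifP.
Qed.

Lemma monomial_geM D Q g1 g2 f1 f2 :
    monomial_ge w D Q g1 f1 -> monomial_ge w D Q g2 f2 ->
  monomial_ge w D Q (g1 + g2) (f1 * f2).
Proof.
move=> [N1 [a1 [le1 ->]]] [N2 [a2 [le2 ->]]].
pose b1 i := if (i < N1)%N then a1 i else 0%N.
pose b2 i := if (i < N2)%N then a2 i else 0%N.
have [s1 ->] := widen_exponent D Q a1 (leq_maxl N1 N2).
have [s2 ->] := widen_exponent D Q a2 (leq_maxr N1 N2).
rewrite s1 in le1; rewrite s2 in le2.
exists (maxn N1 N2), (fun i => b1 i + b2 i)%N; split.
  apply: (le_trans (lerD le1 le2)); rewrite -big_split /=.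
  by apply: ler_sum => i _; rewrite mulrnDr.
by rewrite -big_split /=; apply: eq_bigr => i _; rewrite exprD.
Qed.

Lemma mono_ideal_le D Q g g' f :
  g <= g' -> mono_ideal D Q g' f -> mono_ideal D Q g f.
Proof.
move=> le_gg'; apply: ideal_span_sub => h [N [a [le_a ->]]].
by apply: ideal_span_gen; exists N, a; split=> //; apply: le_trans le_a.
Qed.

Lemma mono_idealM D Q g1 g2 f1 f2 :
    mono_ideal D Q g1 f1 -> mono_ideal D Q g2 f2 ->
  mono_ideal D Q (g1 + g2) (f1 * f2).
Proof.
move=> I1 I2; elim/ideal_span_ind: f1 / I1 => [|c h x Sh IH].
  by rewrite mul0r; apply: ideal_span0.
rewrite mulrDl; apply: ideal_spanD => // {x IH}.
rewrite -mulrA; apply: ideal_spanZ.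
elim/ideal_span_ind: f2 / I2 => [|d l x Sl IH].
  by rewrite mulr0; apply: ideal_span0.
rewrite mulrDr mulrCA; apply: ideal_span_cons => //.
exact: monomial_geM.
Qed.

Lemma mono_ideal1 D Q f : mono_ideal D Q 0 f.
Proof.
rewrite -[f]mulr1; apply: ideal_spanZ; apply: ideal_span_gen.
by exists 0%N, (fun=> 0%N); rewrite !big_ord0.
Qed.

Lemma mono_ideal_mem D Q i : D i -> mono_ideal D Q (w (Q i)) (Q i).
Proof.
move=> Di; apply: ideal_span_gen; exists i.+1, (fun j => (j == i) : nat).
have ne (j : 'I_i.+1) : j != ord_max -> (j : nat) == i = false.
  by rewrite -val_eqE /= => /negPf.
split; rewrite (bigD1 ord_max) //= eqxx.
  by rewrite big1 ?addr0 // => j /andP[_ /ne->]; rewrite mulr0n.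
by rewrite big1 ?mulr1 ?expr1 // => j /andP[_ /ne->].
Qed.

Lemma mono_idealX D Q g f m :
  mono_ideal D Q g f -> mono_ideal D Q (g *+ m) (f ^+ m).
Proof.
move=> If; elim: m => [|m IHm]; first exact: mono_ideal1.
by rewrite mulrS exprS; apply: mono_idealM.
Qed.

(** Membership is asked only of factors that really occur: some T_j or H_l with exponent 0 are not
    known to lie in the target ideal when this is applied. *)
Lemma mono_ideal_prod D Q (D' : pred nat) (Q' : nat -> R) N a :
    (forall i, (i < N)%N -> D' i -> a i != 0%N ->
       mono_ideal D Q (w (Q' i)) (Q' i)) ->
  mono_ideal D Q (\sum_(i < N | D' i) w (Q' i) *+ a i)
                 (\prod_(i < N | D' i) Q' i ^+ a i).
Proof.
move=> IQ'; apply: (big_rec2 (mono_ideal D Q)); first exact: mono_ideal1.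
move=> i f g D'i IH; apply: mono_idealM => //.
have [->|ai_neq0] := eqVneq (a i) 0%N; first exact: mono_ideal1.
by apply: mono_idealX; apply: IQ'.
Qed.

Lemma mono_ideal_trans D Q (D' : pred nat) (Q' : nat -> R) :
    (forall i, D' i -> mono_ideal D Q (w (Q' i)) (Q' i)) ->
  forall g f, mono_ideal D' Q' g f -> mono_ideal D Q g f.
Proof.
move=> IQ' g; apply: ideal_span_sub => _ [N [a [le_a ->]]].
by apply: (mono_ideal_le le_a); apply: mono_ideal_prod => i _ /IQ'.
Qed.

Lemma mono_ideal_gt0 D Q g : mono_ideal_gt D Q g 0.
Proof. by exists (g + 1); [rewrite ltrDl | apply: ideal_span0]. Qed.

Lemma mono_ideal_gtD D Q g f1 f2 :
    mono_ideal_gt D Q g f1 -> mono_ideal_gt D Q g f2 ->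
  mono_ideal_gt D Q g (f1 + f2).
Proof.
move=> [g1 lt1 I1] [g2 lt2 I2]; exists (Num.min g1 g2).
  by rewrite lt_min lt1.
by apply: ideal_spanD; [apply: mono_ideal_le I1 | apply: mono_ideal_le I2];
  rewrite ge_min lexx ?orbT.
Qed.

Lemma mono_ideal_gtM D Q g1 g2 f1 f2 :
    mono_ideal D Q g1 f1 -> mono_ideal_gt D Q g2 f2 ->
  mono_ideal_gt D Q (g1 + g2) (f1 * f2).
Proof.
move=> I1 [g lt2 I2]; exists (g1 + g); first by rewrite ltrD2l.
exact: mono_idealM.
Qed.

Lemma mono_ideal_gtZ D Q g c f :
  mono_ideal_gt D Q g f -> mono_ideal_gt D Q g (c * f).
Proof. by rewrite -{2}[g]add0r; apply/mono_ideal_gtM/mono_ideal1. Qed.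

Lemma mono_ideal_gtX D Q g x y m :
    mono_ideal D Q g x -> mono_ideal D Q g y -> mono_ideal_gt D Q g (x - y) ->
  mono_ideal_gt D Q (g *+ m) (x ^+ m - y ^+ m).
Proof.
move=> Ix Iy Ixy; elim: m => [|m IHm]; first by rewrite subrr;
  apply: mono_ideal_gt0.
have ->: x ^+ m.+1 - y ^+ m.+1 = x * (x ^+ m - y ^+ m) + y ^+ m * (x - y).
  by rewrite !exprS; ring.
apply: mono_ideal_gtD; first by rewrite mulrS; apply: mono_ideal_gtM.
by rewrite mulrSr; apply: mono_ideal_gtM => //; apply: mono_idealX.
Qed.

End MonomialIdeal.

(** * Valuations *)

Section Valuation.

Variables (R : idomainType) (w : R -> rat).
Implicit Types (D : pred nat) (Q : nat -> R) (g : rat) (f : R) (a : nat -> nat).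
Hypothesis wM : forall f g : R, f != 0 -> g != 0 -> w (f * g) = w f + w g.
Hypothesis wD : forall f g : R, f != 0 -> g != 0 -> f + g != 0 ->
  Num.min (w f) (w g) <= w (f + g).
Hypothesis w_ge0 : forall f : R, f != 0 -> 0 <= w f.
Hypothesis w_gt0 : forall f : R, f != 0 -> (0 < w f) = (f \isn't a GRing.unit).

Lemma val1 : w 1 = 0.
Proof. by have := wM (oner_neq0 R) (oner_neq0 R); rewrite mulr1; lra. Qed.

Lemma valX f m : f != 0 -> w (f ^+ m) = w f *+ m.
Proof.
move=> f_neq0; elim: m => [|m IHm]; first exact: val1.
by rewrite exprS mulrS wM ?expf_neq0 // IHm.
Qed.

Lemma val_unit f : f \is a GRing.unit -> w f = 0.
Proof.
move=> Uf; have f_neq0 : f != 0 by apply: contraTneq Uf => ->; rewrite unitr0.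
by apply/eqP; rewrite eq_le w_ge0 // leNgt w_gt0 // Uf.
Qed.

Lemma val_prod D Q a N :
    (forall i, D i -> Q i != 0) ->
  \prod_(i < N | D i) Q i ^+ a i != 0
  /\ w (\prod_(i < N | D i) Q i ^+ a i) = \sum_(i < N | D i) w (Q i) *+ a i.
Proof.
move=> Q_neq0; apply: (big_rec2 (fun f g => f != 0 /\ w f = g)).
  by rewrite oner_neq0 val1.
move=> i f g Di [f_neq0 <-]; have Qi_neq0 := expf_neq0 (a i) (Q_neq0 i Di).
by rewrite mulf_neq0 // wM // valX ?Q_neq0.
Qed.

Lemma val_filtrationD g f1 f2 :
  val_filtration w g f1 -> val_filtration w g f2 -> val_filtration w g (f1 +
    f2).
Proof.
case=> [-> | le1]; first by rewrite add0r.
case=> [-> | le2]; first by rewrite addr0; right.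
have [-> | f1_neq0] := eqVneq f1 0; first by rewrite add0r; right.
have [-> | f2_neq0] := eqVneq f2 0; first by rewrite addr0; right.
have [-> | s_neq0] := eqVneq (f1 + f2) 0; first by left.
right; apply: le_trans (wD f1_neq0 f2_neq0 s_neq0).
by rewrite le_min le1.
Qed.

Lemma val_filtrationZ g c f : val_filtration w g f -> val_filtration w g (c *
  f).
Proof.
case=> [-> | le_f]; first by rewrite mulr0; left.
have [-> | c_neq0] := eqVneq c 0; first by rewrite mul0r; left.
have [-> | f_neq0] := eqVneq f 0; first by rewrite mulr0; left.
by right; rewrite wM // (le_trans le_f) // lerDr w_ge0.
Qed.

Lemma mono_ideal_val D Q g f :
  (forall i, D i -> Q i != 0) -> mono_ideal w D Q g f -> val_filtration w g f.
Proof.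
move=> Q_neq0; elim/ideal_span_ind=> [|c _ x [N [a [le_a ->]]] IH];
  first by left.
apply: val_filtrationD => //; apply: val_filtrationZ; right.
by case: (val_prod a N Q_neq0) => _ ->.
Qed.

Lemma mono_ideal_gt_val D Q f :
  (forall i, D i -> Q i != 0) -> f != 0 -> ~ mono_ideal_gt w D Q (w f) f.
Proof.
move=> Q_neq0 f_neq0 [g ltg /(mono_ideal_val Q_neq0)[f0 | le_g]].
  by rewrite f0 eqxx in f_neq0.
by rewrite leNgt ltg in le_g.
Qed.

Lemma monomial_ge_cases D Q g f : monomial_ge w D Q g f ->
  mono_ideal_gt w D Q g f
  \/ exists N a, g = \sum_(i < N | D i) w (Q i) *+ a i
               /\ f = \prod_(i < N | D i) Q i ^+ a i.
Proof.
move=> [N [a []]]; rewrite le_eqVlt => /predU1P[-> | lt_g] ->; [right | left].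
  by exists N, a.
by eexists; first exact: lt_g; apply: ideal_span_gen; exists N, a.
Qed.

(** If no monomial had value exactly w f, all generators of the ideal at level w f would have larger
    value, and so would f. This yields the value relations that minimality refutes. *)
Lemma generating_sequence_val D Q f :
    (forall i, D i -> Q i != 0) -> f != 0 -> generating_sequence w D Q ->
  exists N a, w f = \sum_(i < N | D i) w (Q i) *+ a i.
Proof.
move=> Q_neq0 f_neq0 genQ.
have /genQ/(_ f)[/(_ (or_intror (lexx _)))+ _] : value_semigroup w (w f).
  by exists f.
have: forall h, mono_ideal w D Q (w f) h -> mono_ideal_gt w D Q (w f) h
    \/ exists N a, w f = \sum_(i < N | D i) w (Q i) *+ a i.
  move=> h; elim/ideal_span_ind=> [|c x y Sx [IH|]]; try by [left;
    apply: mono_ideal_gt0 | right].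
  case/monomial_ge_cases: Sx => [gtx | [N [a [-> _]]]]; last by right;
    exists N, a.
  by left; apply: mono_ideal_gtD => //; apply: mono_ideal_gtZ.
by move=> /(_ f)/[apply] -[/(mono_ideal_gt_val Q_neq0 f_neq0)|].
Qed.

(** The level g = w f is the strongest requirement on f, since the monomial ideals decrease with
    g. *)
Lemma generating_sequenceP D Q :
    (forall i, D i -> Q i != 0) ->
    (forall f, f != 0 -> mono_ideal w D Q (w f) f) ->
  generating_sequence w D Q.
Proof.
move=> Q_neq0 IQ g _ f; split; last exact: mono_ideal_val.
have [-> _ | f_neq0 [f0 | le_g]] := eqVneq f 0; first exact: ideal_span0.
  by rewrite f0 eqxx in f_neq0.
exact/(mono_ideal_le le_g)/IQ.
Qed.

(** * Jumping polynomials *)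

Variables (T : nat -> R) (p q : nat -> nat) (n : nat -> nat -> nat).
(** [mu i] stands for the unit lambda_i delta_i. *)
Variable mu : nat -> R.
Hypothesis w_T0 : w (T 0%N) = 1.
Hypothesis w_T1 : w (T 1%N) = (p 1)%:R / (q 1)%:R.
Hypothesis pq_coprime : forall i, (0 < i)%N ->
  [/\ (0 < p i)%N, (0 < q i)%N & coprime (p i) (q i)].
Hypothesis n_lt : forall i j, (0 < j < i)%N -> (n i j < q j)%N.
Hypothesis w_jp : forall i, (0 < i)%N -> w (T i) *+ q i = w (jp_monomial T n i).
Hypothesis mu_unit : forall i, (0 < i)%N -> mu i \is a GRing.unit.
Hypothesis TS : forall i, (0 < i)%N ->
  T i.+1 = T i ^+ q i - mu i * jp_monomial T n i.
Hypothesis T_neq0 : forall i, T i != 0.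
Hypothesis w_TS : forall i, (0 < i)%N -> w (T i.+1) = w (T i) *+ q i +
  (\prod_(1 <= j < i.+1) (q j)%:R)^-1 * ((p i.+1)%:R / (q i.+1)%:R).
Hypothesis max_idealP : forall f, f \isn't a GRing.unit ->
  exists c d, f = c * T 0%N + d * T 1%N.

Lemma w_jpE i : (0 < i)%N -> w (T i) *+ q i = \sum_(j < i) w (T j) *+ n i j.
Proof. by move=> i_gt0; rewrite w_jp //; case: (@val_prod predT T (n i) i). Qed.

Lemma w_T_gt0 i : 0 < w (T i).
Proof.
have p1q1_gt0 i' : (0 < i')%N -> 0 < (p i')%:R / (q i')%:R :> rat.
  by case/pq_coprime=> *; rewrite divr_gt0 ?ltr0n.
case: i => [|[|i]]; first by rewrite w_T0.
  by rewrite w_T1 p1q1_gt0.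
rewrite w_TS // ltr_wpDl ?mulrn_wge0 ?w_ge0 // mulr_gt0 ?p1q1_gt0 //.
rewrite invr_gt0 big_nat prodr_gt0 // => j /andP[j_gt0 _].
by rewrite ltr0n; case: (pq_coprime j_gt0).
Qed.

Lemma w_T_lt i : (0 < i)%N -> w (T i) *+ q i < w (T i.+1).
Proof.
move=> i_gt0; rewrite w_TS // ltrDl mulr_gt0 //.
  rewrite invr_gt0 big_nat prodr_gt0 // => j /andP[j_gt0 _].
  by rewrite ltr0n; case: (pq_coprime j_gt0).
by have [//| p_gt0 q_gt0 _] := @pq_coprime i.+1; rewrite divr_gt0 ?ltr0n.
Qed.

Lemma w_T_mono i j : (0 < i <= j)%N -> w (T i) <= w (T j).
Proof.
case/andP=> i_gt0; elim: j => [|j IHj]; first by rewrite leqNgt i_gt0.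
rewrite leq_eqVlt => /predU1P[-> // | le_ij].
apply: le_trans (IHj le_ij) _; apply: le_trans (ltW (w_T_lt _));
  last exact: leq_trans i_gt0 le_ij.
have [|_ q_gt0 _] := @pq_coprime j; first exact: leq_trans i_gt0 le_ij.
by rewrite -[q j]prednK // mulrS lerDl mulrn_wge0 ?w_ge0.
Qed.

(** * Denominators of the values of the T_i *)

Definition jp_den i : nat := \prod_(1 <= j < i.+1) q j.

Lemma jp_den_gt0 i : (0 < jp_den i)%N.
Proof.
rewrite /jp_den big_nat; apply: prodn_cond_gt0 => j /andP[/pq_coprime[]] //.
Qed.

Lemma jp_denS i : jp_den i.+1 = (jp_den i * q i.+1)%N.
Proof. by rewrite /jp_den big_nat_recr. Qed.

(* [jp_den i] generates the denominators of the group spanned by the values of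
   T_0, ..., T_i; coprimality says that q_i is the order of the value of T_i
   modulo the previous group. *)
Lemma w_T_den i : exists b : nat, w (T i) = b%:R / (jp_den i)%:R
  /\ ((0 < i)%N -> coprime b (q i)).
Proof.
elim: i => [|[|i] [b [wTb co_b]]].
- by exists 1%N; rewrite w_T0 /jp_den big_geq.
- exists (p 1%N); rewrite w_T1 /jp_den big_nat1; split=> // _.
  by case: (@pq_coprime 1%N).
have [//|p_gt0 q_gt0 co_pq] := @pq_coprime i.+2.
exists (b * q i.+1 * q i.+2 + p i.+2)%N; split; last first.
  by rewrite /coprime gcdnC gcdnMDl gcdnC.
have den_neq0: (jp_den i.+1)%:R != 0 :> rat by rewrite pnatr_eq0 -lt0n
  jp_den_gt0.
have q_neq0: (q i.+2)%:R != 0 :> rat by rewrite pnatr_eq0 -lt0n.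
rewrite w_TS // wTb -natr_prod -/(jp_den i.+1) [in RHS]jp_denS -mulr_natr.
rewrite natrD !natrM; field; exact/andP.
Qed.

Lemma w_monomial_den i a :
  exists z : nat, \sum_(j < i.+1) w (T j) *+ a j = z%:R / (jp_den i)%:R.
Proof.
elim: i => [|i [z sz]].
  by exists (a 0%N); rewrite big_ord1 w_T0 /jp_den big_geq // divr1.
have [b [wTb _]] := w_T_den i.+1; have [//|_ q_gt0 _] := @pq_coprime i.+1.
exists (z * q i.+1 + b * a i.+1)%N; rewrite big_ord_recr /= sz wTb jp_denS.
have den_neq0: (jp_den i)%:R != 0 :> rat by rewrite pnatr_eq0 -lt0n jp_den_gt0.
have q_neq0: (q i.+1)%:R != 0 :> rat by rewrite pnatr_eq0 -lt0n.
by rewrite -mulr_natr natrD !natrM; field; apply/andP.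
Qed.

(** Over the common denominator the relation reads z q_i + b x = z' q_i, where b, the numerator of
    w(T_i), is coprime to q_i. *)
Lemma jp_order i a a' x : (0 < i)%N ->
    \sum_(j < i) w (T j) *+ a j + w (T i) *+ x = \sum_(j < i) w (T j) *+ a' j ->
  (q i %| x)%N.
Proof.
case: i => // i _; have [z ->] := w_monomial_den i a.
have [z' ->] := w_monomial_den i a'; have [b [-> co_b]] := w_T_den i.+1.
have [//|_ q_gt0 _] := @pq_coprime i.+1; rewrite jp_denS => eq_z.
have den_neq0: (jp_den i)%:R != 0 :> rat by rewrite pnatr_eq0 -lt0n jp_den_gt0.
have q_neq0: (q i.+1)%:R != 0 :> rat by rewrite pnatr_eq0 -lt0n.
have: (z * q i.+1 + b * x)%N%:R = (z' * q i.+1)%N%:R :> rat.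
  transitivity ((z%:R / (jp_den i)%:R + b%:R / (jp_den i * q i.+1)%:R *+ x)
                * (jp_den i)%:R * (q i.+1)%:R : rat).
    by rewrite -mulr_natr natrD !natrM; field; apply/andP.
  by rewrite eq_z !natrM; field.
move/eqP; rewrite eqr_nat => /eqP eq_n.
have co_qb : coprime (q i.+1) b by rewrite coprime_sym co_b.
rewrite -(Gauss_dvdr _ co_qb).
have /dvdn_addr <- : (q i.+1 %| z * q i.+1)%N by apply: dvdn_mull.
by rewrite eq_n dvdn_mull.
Qed.

(** * Leading monomials and the raising of the level *)

Let I := mono_ideal w predT T.
Let I_gt := mono_ideal_gt w predT T.

Lemma mono_ideal_T i : I (w (T i)) (T i).
Proof. exact: mono_ideal_mem. Qed.

Lemma mono_ideal_monomial N a :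
  I (\sum_(j < N) w (T j) *+ a j) (\prod_(j < N) T j ^+ a j).
Proof. by apply: (@mono_ideal_prod _ w predT T predT T) => *;
  apply: mono_ideal_T. Qed.

(** For m = 1 the difference is T_{i+1}, whose value exceeds q_i w(T_i); higher powers follow by
    telescoping. *)
Lemma mono_ideal_gt_TSX i m : (0 < i)%N ->
  I_gt (w (T i) *+ q i *+ m)
       ((T i ^+ q i) ^+ m - (mu i * jp_monomial T n i) ^+ m).
Proof.
move=> i_gt0; apply: mono_ideal_gtX; first exact/mono_idealX/mono_ideal_T.
  by apply: ideal_spanZ; rewrite w_jpE //; apply: mono_ideal_monomial.
by rewrite -TS //; exists (w (T i.+1)); [apply: w_T_lt | apply: mono_ideal_T].
Qed.

Lemma monomial_congr N a a' :
    \sum_(j < N) w (T j) *+ a j = \sum_(j < N) w (T j) *+ a' j ->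
  exists2 d, d \is a GRing.unit
    & I_gt (\sum_(j < N) w (T j) *+ a j)
           (\prod_(j < N) T j ^+ a j - d * \prod_(j < N) T j ^+ a' j).
Proof.
elim: N a a' => [|i IHi] a a'.
  move=> _; exists 1; first exact: unitr1.
  by rewrite !big_ord0 mul1r subrr; apply: mono_ideal_gt0.
wlog le_a: a a' / (a' i <= a i)%N => [IH eq_w | eq_w].
  have [/IH | /ltnW/IH] := leqP (a' i) (a i); first exact.
  case=> [//| d Ud Id]; exists d^-1; first by rewrite unitrV.
  rewrite eq_w; have := mono_ideal_gtZ (- d^-1) Id; congr (I_gt _ _).
  by rewrite mulrBr !mulrA !mulNr mulVr // mul1r opprK addrC.
(* With T_0 alone, of value 1, equal values force equal exponents. *)
have [i0 | i_gt0] := posnP i.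
  exists 1; first exact: unitr1.
  rewrite mul1r (_ : _ - _ = 0); first exact: mono_ideal_gt0.
  move: eq_w; rewrite i0 !big_ord1 w_T0 => /eqP; rewrite eqr_nat => /eqP ->.
  exact: subrr.
have [x def_ai] : {x | a i = a' i + x}%N by exists (a i - a' i)%N;
  rewrite subnKC.
move: eq_w; rewrite !big_ord_recr /= def_ai mulrnDr => eq_w.
have eq_x : \sum_(j < i) w (T j) *+ a j + w (T i) *+ x
          = \sum_(j < i) w (T j) *+ a' j by lra.
have /dvdnP[m def_x] := jp_order i_gt0 eq_x.
(* Replacing T_i^(q_i m) by the m-th power of its monomial in the earlier T_j leaves the exponents
   b, of the same value as a', and only T_j with j < i. *)
pose b j := (n i j * m + a j)%N.
have wxE : w (T i) *+ x = w (T i) *+ q i *+ m by rewrite -mulrnA def_x mulnC.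
have sum_b : \sum_(j < i) w (T j) *+ b j
    = w (T i) *+ x + \sum_(j < i) w (T j) *+ a j.
  rewrite wxE w_jpE // -sumrMnl -big_split.
  by apply: eq_bigr => j _; rewrite /b mulrnDr mulrnA.
have prod_b : \prod_(j < i) T j ^+ b j
    = jp_monomial T n i ^+ m * \prod_(j < i) T j ^+ a j.
  rewrite -prodrXl -big_split.
  by apply: eq_bigr => j _; rewrite /b exprD exprM.
have [|d Ud] := IHi b a'; first by rewrite sum_b addrC.
rewrite sum_b prod_b => Id; exists (mu i ^+ m * d).
  by rewrite unitrM Ud unitrX ?mu_unit.
set A := \prod_(j < i) T j ^+ a j in prod_b Id *.
set A' := \prod_(j < i) T j ^+ a' j in Id *.
(* The first summand is the error of that replacement, the second the error from the induction
   hypothesis. *)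
have ->: A * T i ^+ (a' i + x) - mu i ^+ m * d * (A' * T i ^+ a' i)
    = T i ^+ a' i * (A * ((T i ^+ q i) ^+ m - (mu i * jp_monomial T n i) ^+ m)
                     + mu i ^+ m * (jp_monomial T n i ^+ m * A - d * A')).
  by rewrite def_x mulnC exprD exprM exprMn; ring.
rewrite (_ : _ + _ = w (T i) *+ a' i
    + (\sum_(j < i) w (T j) *+ a j + w (T i) *+ q i *+ m)); last first.
  by rewrite -wxE; ring.
apply: mono_ideal_gtM; first exact/mono_idealX/mono_ideal_T.
apply: mono_ideal_gtD; first by apply: mono_ideal_gtM (mono_ideal_monomial _ _)
  (mono_ideal_gt_TSX _ _).
by apply: mono_ideal_gtZ; rewrite -wxE addrC.
Qed.

(** Terms of value above g are absorbed. Those of value exactly g are all unit multiples of one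
    monomial up to higher terms, so their coefficients add up to a single e. *)
Lemma mono_ideal_leading g f : I g f ->
  I_gt g f \/ exists N a e, g = \sum_(j < N) w (T j) *+ a j
                          /\ I_gt g (f - e * \prod_(j < N) T j ^+ a j).
Proof.
elim/ideal_span_ind=> [|c f1 x /monomial_ge_cases cf1 IH].
  by left; apply: mono_ideal_gt0.
case: cf1 => [gt_f1 | [N [a [gE f1E]]]].
  case: IH => [gt_x | [N [a [e [gE gt_x]]]]].
    by left; apply: mono_ideal_gtD => //; apply: mono_ideal_gtZ.
  right; exists N, a, e; split=> //; rewrite -addrA.
  by apply: mono_ideal_gtD => //; apply: mono_ideal_gtZ.
right; case: IH => [gt_x | [N' [a' [e [gE' gt_x]]]]].
  by exists N, a, c; split=> //; rewrite f1E addrAC subrr add0r.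
pose b i := if (i < N)%N then a i else 0%N.
pose b' i := if (i < N')%N then a' i else 0%N.
have [s1 p1] := @widen_exponent _ w predT T N _ a (leq_maxl N N').
have [s2 p2] := @widen_exponent _ w predT T N' _ a' (leq_maxr N N').
rewrite p1 in f1E; rewrite p2 in gt_x; rewrite s1 in gE; rewrite s2 in gE'.
have [|d Ud Id] := @monomial_congr (maxn N N') b b'; first by rewrite -gE -gE'.
exists (maxn N N'), b', (c * d + e); split=> //.
set M := \prod_(_ < _) _ in f1E Id.
set M' := \prod_(_ < _) _ in gt_x Id *.
rewrite f1E (_ : _ - _ = c * (M - d * M') + (x - e * M')); last by ring.
by apply: mono_ideal_gtD => //; apply: mono_ideal_gtZ; rewrite gE.
Qed.

Lemma mono_ideal_gt_of_val g f : f != 0 -> g < w f -> I g f -> I_gt g f.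
Proof.
move=> f_neq0 ltgw /mono_ideal_leading[// | [N [a [e [gE gt_f]]]]].
have Pneq0 i : predT i -> T i != 0 by [].
have [M_neq0 wM_E] := val_prod a N Pneq0.
set M := \prod_(_ < _) _ in gt_f M_neq0 wM_E.
suff: I_gt g (e * M) by move=> /(mono_ideal_gtD gt_f); rewrite subrK.
case: (boolP (e \is a GRing.unit)) => [Ue | /max_idealP[c [d ->]]]; last first.
  (* A nonunit e is a combination of T_0 and T_1, whose positive values push e M beyond g. *)
  have IM : I g M by rewrite gE; apply: mono_ideal_monomial.
  rewrite mulrDl -!mulrA; apply: mono_ideal_gtD; apply: mono_ideal_gtZ;
  by eexists; last exact/mono_idealM/IM/mono_ideal_T; rewrite ltrDr w_T_gt0.
(* For a unit e, the value of e M is g; but e M is the difference of f and f - e M, both of value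
   above g, a contradiction. *)
have e_neq0 : e != 0 by apply: contraTneq Ue => ->; rewrite unitr0.
case: gt_f => g' lt_g' /(mono_ideal_val Pneq0) val_f.
have: val_filtration w (Num.min g' (w f)) (e * M).
  rewrite -[e * M](subKr f); apply: val_filtrationD.
    by right; rewrite ge_min lexx orbT.
  rewrite -mulN1r; apply: val_filtrationZ.
  by case: val_f => [->|le_g']; [left | right; rewrite ge_min le_g'].
case=> [/eqP|]; first by rewrite mulf_eq0 (negPf e_neq0) (negPf M_neq0).
by rewrite wM // (val_unit Ue) add0r wM_E -gE leNgt lt_min lt_g' ltgw.
Qed.

(** * Independent jumping polynomials *)

Variable idx : nat -> nat.
Hypothesis idx_indep : independent_indices q idx.
Let H l := T (idx l).

Lemma idx0 : idx 0 = 0%N.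
Proof.
have [idx_mono /(_ 0%N)[/(_ isT)[l idxl] _]] := idx_indep.
by case: l idxl => // l idxl; have := idx_mono 0%N l.+1 isT; rewrite idxl ltn0.
Qed.

Lemma idx_gt0 l : (0 < l)%N -> (0 < idx l)%N.
Proof. by case: idx_indep => idx_mono _ /idx_mono; rewrite idx0. Qed.

Lemma q_idx l : (0 < l)%N -> (1 < q (idx l))%N.
Proof.
move=> l_gt0; have [//|_ q_gt0 _] := @pq_coprime (idx l); first exact: idx_gt0.
case: idx_indep => _ /(_ (idx l))[_ /(_ (ex_intro _ l erefl))].
by rewrite /independent_jp -leqn0 leqNgt idx_gt0 //= => q_neq1;
  rewrite ltn_neqAle eq_sym q_neq1.
Qed.

(** At an independent index q is at least 2, so the value at least doubles there and gains at least
    w(T_1). *)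
Lemma w_idx_ge l : w (T 1) *+ l <= w (T (idx l).+1).
Proof.
elim: l => [|l IHl]; first by rewrite mulr0n w_ge0.
have idx_lt : (idx l < idx l.+1)%N by case: idx_indep => idx_mono _;
  apply: idx_mono.
have idx_pos : (0 < idx l.+1)%N by apply: leq_ltn_trans idx_lt.
apply: le_trans (ltW (w_T_lt idx_pos)).
have le1 : w (T 1%N) <= w (T (idx l.+1)) by apply: w_T_mono.
have le2 : w (T 1%N) *+ l <= w (T (idx l.+1)).
  by apply: le_trans IHl _; apply: w_T_mono.
rewrite mulrS (le_trans (lerD le1 le2)) // -mulr2n.
by apply: ler_wpMn2l; [apply: w_ge0 | apply: q_idx].
Qed.

Lemma w_T_unbounded g : exists N, forall j, (N <= j)%N -> g <= w (T j).
Proof.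
have [m le_g] : exists m : nat, g <= w (T 1%N) *+ m.
  exists (Num.truncn (g / w (T 1%N))).+1;
    rewrite -mulr_natl -ler_pdivrMr ?w_T_gt0 //.
  exact/ltW/truncnS_gt.
exists (idx m).+1 => j le_j; apply: (le_trans le_g).
by apply: le_trans (w_idx_ge m) _; apply: w_T_mono.
Qed.

(** A factor T_j with j > N would already bring the value up to g, so only T_0, ..., T_N occur, with
    common denominator [jp_den N]. *)
Lemma w_monomial_small N g a M :
    (forall j, (N <= j)%N -> g <= w (T j)) -> \sum_(j < M) w (T j) *+ a j < g ->
  exists z : nat, \sum_(j < M) w (T j) *+ a j = z%:R / (jp_den N)%:R.
Proof.
move=> large lt_g; pose b j := if (j < M)%N then a j else 0%N.
have [z zE] := w_monomial_den N b; exists z; rewrite -{}zE.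
have [-> _] := @widen_exponent _ w predT T _ _ a (leq_maxl M N.+1).
have [-> _] := @widen_exponent _ w predT T _ _ b (leq_maxr M N.+1).
apply: eq_bigr => -[j /= _] _; rewrite /b; case: ifP => ltjM; last by case: ifP.
case: ifP => // /negbT; rewrite -leqNgt => ltNj.
suff ->: a j = 0%N by [].
apply: contraTeq lt_g; rewrite -lt0n -leNgt => aj_gt0.
rewrite (bigD1 (Ordinal ltjM)) //= ler_wpDr //.
  by apply: sumr_ge0 => i _; rewrite mulrn_wge0 ?w_ge0.
apply: le_trans (large j (ltnW ltNj)) _.
by rewrite -[a j]prednK // mulrS lerDl mulrn_wge0 ?w_ge0.
Qed.

Lemma mono_ideal_full f : f != 0 -> I (w f) f.
Proof.
move=> f_neq0; have [N largeN] := w_T_unbounded (w f).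
have den_gt0 : 0 < (jp_den N)%:R :> rat by rewrite ltr0n jp_den_gt0.
(* The level climbs in steps of 1 / [jp_den N] and is capped at w f. *)
have step m : I (Num.min (m%:R / (jp_den N)%:R) (w f)) f.
  elim: m => [|m IHm]; first by apply: (mono_ideal_le _ (mono_ideal1 _ _ _ _));
    rewrite mul0r ge_min lexx.
  case: (lerP (w f) (m%:R / (jp_den N)%:R)) IHm => [le_m|lt_m] IHm.
    by apply: mono_ideal_le IHm; rewrite ge_min lexx orbT.
  have [g lt_g] := mono_ideal_gt_of_val f_neq0 lt_m IHm.
  apply: ideal_span_sub => _ [M [a [le_a ->]]].
  apply: ideal_span_gen; exists M, a; split=> //.
  (* A monomial value below w f is z / [jp_den N]; being above m / [jp_den N], it has z >= m + 1. *)
  rewrite ge_min orbC; case: lerP => //= lt_a.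
  have [z zE] := w_monomial_small largeN lt_a.
  have := lt_le_trans lt_g le_a; rewrite zE.
  by rewrite ltr_pM2r ?ler_pM2r ?invr_gt0 // ltr_nat ler_nat.
apply: mono_ideal_le (step (Num.truncn (w f * (jp_den N)%:R)).+1).
rewrite le_min lexx andbT ler_pdivlMr //.
exact/ltW/truncnS_gt.
Qed.

Lemma H_neq0 l : H l != 0.
Proof. exact: T_neq0. Qed.

Lemma indep_jp_mem i : independent_jp q i -> mono_ideal w predT H (w (T i)) (T
  i).
Proof.
move=> indep_i; have [_ /(_ i)[/(_ indep_i)[l <-] _]] := idx_indep.
exact: (mono_ideal_mem w H).
Qed.

(** Descending induction from some independent index idx l >= i. For a dependent T_i, q_i = 1 and
    the recursion expresses T_i through T_{i+1}, of larger value, and a monomial of the same value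
    as T_i. *)
Lemma T_mem_H i : mono_ideal w predT H (w (T i)) (T i).
Proof.
have [l /subnK] : exists l, (i <= idx l)%N.
  exists i; elim: i => // i IHi; apply: leq_ltn_trans IHi _.
  by case: idx_indep => idx_mono _; apply: idx_mono.
move: (idx l - i)%N => d; elim: d i => [|d IHd] i eq_idx.
  by rewrite -[i]add0n eq_idx; apply: (mono_ideal_mem w H).
have [/indep_jp_mem // | ] := boolP (independent_jp q i).
rewrite negb_or negbK -lt0n => /andP[i_gt0 /eqP qi1].
have TE: T i = T i.+1 + mu i * jp_monomial T n i by rewrite TS // qi1 subrK.
rewrite [X in mono_ideal _ _ _ _ X]TE.
apply: ideal_spanD; last apply: ideal_spanZ.
  apply: mono_ideal_le (IHd i.+1 _); last by rewrite addnS -addSn.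
  by have := w_T_lt i_gt0; rewrite qi1 => /ltW.
rewrite -[w (T i)]/(w (T i) *+ 1) -qi1 w_jpE //.
(* For j > 0 the bound n_{i,j} < q_j excludes factors with q_j = 1, so every factor that occurs is
   independent. *)
apply: (@mono_ideal_prod _ w predT H predT T) => j lt_ji _ nij_neq0.
apply: indep_jp_mem; rewrite /independent_jp -leqn0 leqNgt.
case: ltnP => //= j_gt0; apply: contraNneq nij_neq0 => qj1.
by have := @n_lt i j; rewrite j_gt0 lt_ji qj1 ltnS leqn0 => /(_ isT).
Qed.

Lemma H_generating : generating_sequence w predT H.
Proof.
apply: generating_sequenceP => [i _|f f_neq0]; first exact: H_neq0.
by apply: (mono_ideal_trans (D' := predT) (Q' := T)) (mono_ideal_full f_neq0)
  => i _; apply: T_mem_H.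
Qed.

(** * Values of H_l outside the semigroup of the others *)

Lemma sum_val_ind D N a (P : rat -> Prop) :
    P 0 -> (forall x y, P x -> P y -> P (x + y)) ->
    let g := \sum_(l < N | D l) w (H l) *+ a l in
    (forall l, D l -> w (H l) <= g -> P (w (H l))) ->
  P g.
Proof.
move=> P0 PD g PH; rewrite {1}/g; apply: (big_ind P) => // l Dl.
have [-> // | al_neq0] := eqVneq (a l) 0%N.
(* All values being nonnegative, a factor that occurs has value at most g. *)
have Pl : P (w (H l)).
  apply: PH => //; rewrite /g (bigD1 l) //= ler_wpDr //.
    by apply: sumr_ge0 => *; rewrite mulrn_wge0 // w_ge0 ?H_neq0.
  rewrite -[a l]prednK ?lt0n // mulrS lerDl mulrn_wge0 // w_ge0 //.
  exact: H_neq0.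
by elim: (a l) => // m IHm; rewrite mulrS; apply: PD.
Qed.

(** Each H_l with l > i has value above w(H_i), so only l < i could contribute. Then w(H_i) would
    lie in the semigroup of the values of earlier T_j, and [jp_order] with x = 1 would make q at idx
    i divide 1. *)
Lemma H_value_notin D i N a : (0 < i)%N -> ~~ D i ->
  w (H i) <> \sum_(l < N | D l) w (H l) *+ a l.
Proof.
move=> i_gt0 notDi wHi.
pose P x := exists b : nat -> nat, x = \sum_(j < idx i) w (T j) *+ b j.
have: P (w (H i)).
  rewrite wHi; apply: sum_val_ind; rewrite -?wHi.
  - by exists (fun=> 0%N); rewrite big1.
  - move=> _ _ [b ->] [c ->]; exists (fun j => b j + c j)%N.
    by rewrite -big_split; apply: eq_bigr => j _; rewrite mulrnDr.
  move=> l Dl le_l; have lt_l : (idx l < idx i)%N.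
    case: (ltngtP l i) => [lt_li | lt_il | eq_li];
      last by rewrite -eq_li Dl in notDi.
      by case: idx_indep => idx_mono _; apply: idx_mono.
    move: le_l; rewrite leNgt; case/negP.
    have ipos := idx_gt0 i_gt0.
    apply: (@lt_le_trans _ _ (w (T (idx i).+1))); last first.
      by apply: w_T_mono; case: idx_indep => idx_mono _; apply: idx_mono.
    apply: le_lt_trans (w_T_lt ipos).
    have:= q_idx i_gt0; case: (q _) => // m _;
      rewrite mulrS lerDl mulrn_wge0 //.
    exact/ltW/w_T_gt0.
  exists (fun j => j == idx l : nat).
  rewrite (bigD1 (Ordinal lt_l)) //= eqxx big1 ?addr0 // => j.
  by rewrite -val_eqE /= => /negPf ->.
case=> b wHiE; have := @jp_order (idx i) (fun=> 0%N) b 1 (idx_gt0 i_gt0).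
rewrite big1 // add0r => /(_ wHiE); rewrite dvdn1 => /eqP q1.
by have := q_idx i_gt0; rewrite q1.
Qed.

Let i1 := idx 1.
Let pb := pbar p q idx 1.

Lemma q_lt_idx1 j : (0 < j < i1)%N -> q j = 1%N.
Proof.
case/andP=> j_gt0 lt_j; apply: contraTeq isT => qj_neq1.
have [idx_mono /(_ j)[+ _]] := idx_indep.
rewrite /independent_jp qj_neq1 orbT => /(_ isT)[l idxl].
have l_gt0 : (0 < l)%N by case: l idxl => // /esym; rewrite idx0 => j0;
  rewrite j0 in j_gt0.
move: lt_j; rewrite -idxl ltnNge /i1; move: l_gt0; rewrite leq_eqVlt.
by case/predU1P=> [<- | /idx_mono/ltnW ->] //; rewrite leqnn.
Qed.

(** Since q_j = 1 for 0 < j < i_1, the recursion adds up to w(T_j) = p_1 + ... + p_{j-1} + p_j / q_j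
    for 0 < j <= i_1. *)
Lemma w_H1 : w (H 1) * (q i1)%:R = pb%:R.
Proof.
have i1_gt0 : (0 < i1)%N by apply: idx_gt0.
have wTj j : (0 < j <= i1)%N ->
    w (T j) = (\sum_(1 <= m < j) p m)%:R + (p j)%:R / (q j)%:R.
  elim: j => // -[|j] IHj /= le_j; first by rewrite w_T1 big_geq // add0r.
  rewrite w_TS // IHj; last exact: ltnW.
  rewrite [in RHS]big_nat_recr //= q_lt_idx1; last by rewrite le_j.
  have -> : \prod_(1 <= m < j.+2) (q m)%:R = 1 :> rat.
    rewrite big_nat big1 // => m /andP[m_gt0 le_m].
    by rewrite q_lt_idx1 // m_gt0 (leq_trans le_m).
  by rewrite invr1 mul1r divr1 natrD.
have q_neq0 : (q i1)%:R != 0 :> rat.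
  by rewrite pnatr_eq0 -lt0n; case: (pq_coprime i1_gt0).
rewrite /H -/i1 wTj ?i1_gt0 //= mulrDl divfK // /pb /pbar idx0 -/i1.
by rewrite natrD natrM.
Qed.

Lemma pb_gt0 : (0 < pb)%N.
Proof. by rewrite /pb /pbar addn_gt0 orbC;
  case: (@pq_coprime i1 (idx_gt0 _)) => // ->. Qed.

(** Each H_l with l >= 2 has value above q w(H_1) = pbar_1 >= 1, where q is q_{i_1}, so 1 = w(H_0)
    would be a multiple m pbar_1 / q. As pbar_1 is congruent to p_{i_1} modulo q, it is coprime to
    q, and q = pbar_1 m forces pbar_1 = 1. *)
Lemma H0_value_notin D N a : pb <> 1%N -> ~~ D 0 ->
  w (H 0) <> \sum_(l < N | D l) w (H l) *+ a l.
Proof.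
move=> pb_neq1 notD0 wH0; have wH0E : w (H 0) = 1 by rewrite /H idx0.
have i1_gt0 : (0 < i1)%N by apply: idx_gt0.
pose P x := exists m, x = w (H 1) *+ m.
have: P (w (H 0)).
  rewrite wH0; apply: sum_val_ind; rewrite -?wH0 ?wH0E.
  - by exists 0%N.
  - by move=> _ _ [b ->] [c ->]; exists (b + c)%N; rewrite mulrnDr.
  case=> [|[|l]] Dl; first by rewrite Dl in notD0.
    by exists 1%N.
  rewrite leNgt; case/negP.
  apply: (@le_lt_trans _ _ (w (T i1) *+ q i1)).
    by rewrite -mulr_natr w_H1 ler1n pb_gt0.
  apply: lt_le_trans (w_T_lt i1_gt0) _.
  by apply: w_T_mono; case: idx_indep => idx_mono _; apply: idx_mono.
case=> m; rewrite wH0E => /(congr1 (fun x => x * (q i1)%:R)).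
rewrite mul1r mulrnAl w_H1 -mulrnA => /eqP; rewrite eqr_nat => /eqP qE.
have: coprime pb (q i1).
  rewrite /coprime gcdnC gcdnMDl gcdnC.
  by case: (pq_coprime i1_gt0).
by rewrite qE /coprime gcdnMr => /eqP.
Qed.

(** * Elimination of H_0 when pbar_1 = 1 *)

Hypothesis R_local : is_local R.

(** Here q w(H_1) = 1 = w(T_0) with q the exponent at i_1, so the recursion reads T_{i_1+1} = H_1^q
    - mu T_0. *)
Lemma T0_mem_H : pb = 1%N -> mono_ideal w [pred l | 0 < l]%N H 1 (T 0).
Proof.
move=> pb1; set J := mono_ideal _ _ _.
have i1_gt0 : (0 < i1)%N by apply: idx_gt0.
have w_i1 : w (T i1) *+ q i1 = 1 by rewrite -mulr_natr w_H1 pb1.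
(* T_{i1+1} may still involve H_0, but only with a coefficient in the maximal
   ideal, so the equation for T_{i1+1} can be solved for T_0. *)
have J_mod g x : 1 < g -> mono_ideal w predT H g x ->
    exists y m, [/\ J 1 y, m \isn't a GRing.unit & x = y + m * T 0%N].
  move=> lt_g; elim/ideal_span_ind=> [|c _ x' [[|N] [a [le_a ->]]] [y [m [Jy Nm
    ->]]]].
  - exists 0, 0; rewrite unitr0 mul0r addr0; split=> //; exact: ideal_span0.
  - by move: (lt_le_trans lt_g le_a); rewrite !big_ord0 ltr10.
  have [M_neq0 wME] := val_prod a N.+1 (fun i (_ : predT i) => H_neq0 i).
  set M := \prod_(_ < _ | _) _ in M_neq0 wME *.
  have lt_M : 1 < w M by rewrite wME (lt_le_trans lt_g).
  (* A monomial without H_0 goes into y; from any other one a factor T_0 is split off. *)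
  have [a0 | a0_neq0] := eqVneq (a 0%N) 0%N.
    exists (c * M + y), m; split=> //; last by rewrite addrA.
    apply: ideal_spanD => //; apply: ideal_spanZ.
    apply: mono_ideal_le (ltW lt_M) _; rewrite wME.
    apply: (@mono_ideal_prod _ w _ H predT H) => i _ _ ai_neq0.
    apply: mono_ideal_mem; rewrite /= lt0n; apply: contraNneq ai_neq0 => ->.
    exact/eqP.
  have [m' def_M] : exists m', M = m' * T 0%N.
    exists (T 0 ^+ (a 0%N).-1 * \prod_(i < N) H (lift ord0 i) ^+ a (lift ord0
      i)).
    rewrite /M big_ord_recl /= -[in LHS](prednK (n := a 0%N)) ?lt0n // exprSr
      /H idx0.
    by rewrite mulrAC.
  have m'_neq0 : m' != 0 by apply: contraNneq M_neq0 => m'0;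
    rewrite def_M m'0 mul0r.
  (* The cofactor has value w(M) - 1 > 0. *)
  have Nm' : m' \isn't a GRing.unit.
    by rewrite -w_gt0 //; move: lt_M; rewrite def_M wM // w_T0; lra.
  exists y, (c * m' + m); split=> //; last by rewrite def_M; ring.
  by apply: R_local => //; rewrite inE unitrM negb_and orbC Nm'.
have [|y [m [Jy Nm TE]]] := J_mod _ _ _ (T_mem_H i1.+1).
  by rewrite -w_i1 w_T_lt.
(* The exponents n_{i_1,j} with 0 < j < i_1 are below q_j = 1, hence zero, and the value 1 leaves
   T_0 to the first power. *)
have jpE : jp_monomial T n i1 = T 0%N.
  have n_eq0 j : (0 < j < i1)%N -> n i1 j = 0%N.
    by move=> lt_j; have := n_lt lt_j; rewrite q_lt_idx1 // ltnS leqn0 => /eqP.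
  have T0_pow N a : (0 < N)%N -> (forall j, (0 < j < N)%N -> a j = 0%N) ->
      \sum_(j < N) w (T j) *+ a j = (a 0%N)%:R
      /\ \prod_(j < N) T j ^+ a j = T 0%N ^+ a 0%N.
    case: N => // N _ a0; rewrite !big_ord_recl /= w_T0.
    by rewrite !big1 ?addr0 ?mulr1 // => j _; rewrite a0 //=;
      apply: (ltn_ord (lift ord0 j)).
  have [sE pE] := T0_pow _ _ i1_gt0 n_eq0.
  move/eqP: (w_jpE i1_gt0); rewrite w_i1 sE eq_sym pnatr_eq1 => /eqP n1.
  by rewrite /jp_monomial pE n1.
move: TE; rewrite TS // jpE => TE.
(* In a local ring, a unit plus a nonunit is a unit. *)
have Um : mu i1 + m \is a GRing.unit.
  apply: contraLR (mu_unit i1_gt0) => N_mu.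
  by rewrite -[mu i1](addrK m); apply: R_local; rewrite inE ?unitrN.
rewrite -(mulKr Um (T 0%N)); apply: ideal_spanZ.
have -> : (mu i1 + m) * T 0%N = T i1 ^+ q i1 + -1 * y.
  by rewrite mulN1r mulrDl -[X in X - y](subrK (mu i1 * T 0%N)) TE; ring.
apply: ideal_spanD; last exact: ideal_spanZ.
by rewrite -w_i1; apply: mono_idealX; apply: (mono_ideal_mem w H).
Qed.

Lemma H_pos_generating : pb = 1%N -> generating_sequence w [pred l | 0 < l]%N H.
Proof.
move=> pb1; apply: generating_sequenceP => [i _|f f_neq0]; first exact: H_neq0.
apply: (mono_ideal_trans (D' := predT) (Q' := H)); last first.
  by apply: (mono_ideal_trans (D' := predT) (Q' := T)) (mono_ideal_full f_neq0)
    => i _; apply: T_mem_H.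
case=> [|i] _; last exact: (mono_ideal_mem w H).
by rewrite /H idx0 w_T0; apply: T0_mem_H.
Qed.

Lemma H_minimal : pb <> 1%N -> minimal_generating_sequence w predT H.
Proof.
move=> pb_neq1; split=> [|D _ [i _ notDi] genD]; first exact: H_generating.
have [N [a wHi]] := generating_sequence_val (fun l _ => H_neq0 l) (H_neq0 i)
  genD.
case: i notDi wHi => [|i] notDi wHi; first exact: H0_value_notin wHi.
exact: H_value_notin wHi.
Qed.

Lemma H_pos_minimal : pb = 1%N ->
  minimal_generating_sequence w [pred l | 0 < l]%N H.
Proof.
move=> pb1; split=> [|D _ [i i_gt0 notDi] genD]; first exact: H_pos_generating.
have [N [a wHi]] := generating_sequence_val (fun l _ => H_neq0 l) (H_neq0 i)
  genD.
exact: H_value_notin wHi.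
Qed.

End Valuation.

Theorem theorem5p7
    (k : closedFieldType) (ch : nat) (k_char : ch \in [pchar k])
    (K : fieldType) (R : idomainType)
    (kR : {rmorphism k -> R}) (RK : {rmorphism R -> K}) (nu : K -> rat)
    (K_ff : function_field (RK \o kR) 2)
    (nu_val : k_valuation (RK \o kR) nu)
    (nu_res : residue_trdeg0 (RK \o kR) nu)
    (R_reg : regular_local_ring R 2)
    (R_eft : essentially_finite_type kR)
    (R_frac : is_fraction_field RK)
    (R_dom : dominated RK nu)
    (u v : R) (uv_par : regular_parameters (fun i : 'I_2 => [:: u; v]`_i))
    (nu_u : nu (RK u) = 1)
    (delta : nat -> R)
    (delta_unit : forall i, (0 < i)%N ->
       delta i \is a GRing.unit /\ delta i - 1 \in max_ideal R)
    (T : nat -> R) (p q : nat -> nat) (n : nat -> nat -> nat) (lam : nat -> k)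
    (T_jp : jumping_polynomials kR RK nu u v delta T p q n lam)
    (idx : nat -> nat) (idx_indep : independent_indices q idx)
    (nondiscrete : ~ discrete_subset (value_group nu)) :
  let w := fun f : R => nu (RK f) in
  let H := fun l : nat => T (idx l) in
  generating_sequence w predT H /\
  (pbar p q idx 1 <> 1%N -> minimal_generating_sequence w predT H) /\
  (pbar p q idx 1 = 1%N ->
     minimal_generating_sequence w [pred l | (0 < l)%N] H).
Proof.
have RK_inj : injective RK by case: R_frac.
have RK_neq0 f : f != 0 -> RK f != 0.
  by rewrite -(rmorph0 RK) => /negP nf; apply/negP => /eqP/RK_inj/eqP.
case: nu_val => nuM nuD _; case: R_dom => R_val R_max.
case: R_reg => R_local _ _ _; case: T_jp => T0 T1 pq_co val1 n_lt wjp lamP TS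
  T_neq0 valS.
(* The properties of nu pass to its restriction w to R; by domination, positive value means being a
   nonunit of R. *)
pose w f := nu (RK f); rewrite -/w.
have wM f g : f != 0 -> g != 0 -> w (f * g) = w f + w g.
  by move=> f0 g0; rewrite /w rmorphM nuM ?RK_neq0.
have wD f g : f != 0 -> g != 0 -> f + g != 0 -> Num.min (w f) (w g) <= w (f +
  g).
  by move=> f0 g0 fg0; rewrite /w rmorphD nuD -?rmorphD ?RK_neq0.
have w_ge0 f : f != 0 -> 0 <= w f.
  by move=> /RK_neq0/negPf f0; have := R_val f; rewrite inE f0.
have w_gt0 f : f != 0 -> (0 < w f) = (f \isn't a GRing.unit).
  move=> /RK_neq0/negPf f0; apply/idP/idP => [w_f | Nf].
    by apply/R_max; rewrite inE w_f orbT.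
  by have /R_max : f \in max_ideal R by []; rewrite inE f0.
have mu_unit i : (0 < i)%N -> kR (lam i) * delta i \is a GRing.unit.
  move=> i_gt0; have [lam_neq0 _] := lamP i i_gt0.
  by rewrite unitrM rmorph_unit ?unitfE //; case: (delta_unit i i_gt0).
have max_idealP f : f \isn't a GRing.unit -> exists c d, f = c * T 0 + d * T 1.
  move=> Nf; have /uv_par : f \in max_ideal R by [].
  elim/ideal_span_ind => [|c _ x [i ->] [a [b ->]]].
    by exists 0, 0; rewrite !mul0r addr0.
  rewrite T0 T1; case: i => -[|[|//]] ? /=.
    by exists (c + a), b; ring.
  by exists a, (c + b); ring.
have w_T0 : w (T 0) = 1 by rewrite T0.
have w_T1 : w (T 1) = (p 1)%:R / (q 1)%:R by rewrite T1.
split; first exact: (H_generating wM wD w_ge0 w_gt0 w_T0 w_T1 pq_co n_lt wjp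
  mu_unit
  TS T_neq0 valS max_idealP idx_indep).
split=> pb; first exact: (H_minimal wM wD w_ge0 w_gt0 w_T0 w_T1 pq_co n_lt wjp
  mu_unit
  TS T_neq0 valS max_idealP idx_indep).
exact: (H_pos_minimal wM wD w_ge0 w_gt0 w_T0 w_T1 pq_co n_lt wjp mu_unit
  TS T_neq0 valS max_idealP idx_indep R_local).
Qed.
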